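(* Consider the problem $\min_{x\in\mathbb{R}^d}F(x)$ with $F(x)=f_A(x)+\sum_{i=1}^d\psi_i(x^{(i)})$, under the assumptions in the context, and let $\theta^\star$ be a minimizer of $F$. If $S^2\ge \frac{M_iR_i}{p_i^2}$ for all $i$ and $1-\beta_t-\frac{\alpha_tR_i}{p_i}\ge0$ for all $i$ and $t$, then the sequences $(v_t),(x_t)$ generated by the generalized APCG algorithm satisfy, for all $t$, $$B_t\,\mathbb{E}\big[\|v_t-\theta^\star\|^2_{A^\dagger A}\big]+2A_t\big[\mathbb{E}[F(x_t)]-F(\theta^\star)\big]\le C_0,$$ where $C_0=B_0\|v_0-\theta^\star\|^2+2A_0[F(x_0)-F(\theta^\star)]$.
   Context: Setting. $A$ is a matrix with $d$ columns, $A^\dagger$ its pseudo-inverse, $\|u\|^2_{A^\dagger A}=u^TA^\dagger Au$, $e_i$ the unit vectors of $\mathbb{R}^d$, $x^{(i)}=e_i^Tx$, $R_i=e_i^TA^\dagger Ae_i$. Each $\psi_i:\mathbb{R}\to\mathbb{R}\cup\{+\infty\}$ is convex. $f_A:\mathbb{R}^d\to\mathbb{R}$ is differentiable and there is $\sigma_A\ge0$ with $f_A(x)-f_A(y)\ge\nabla f_A(y)^TA^\dagger A(x-y)+\frac{\sigma_A}{2}(x-y)^TA^\dagger A(x-y)$ for all $x,y$. $\nabla_if_A=e_ie_i^T\nabla f_A$, and $f_A$ is $M_i$-smooth in direction $i$ (its partial derivative along $e_i$ is $M_i$-Lipschitz along $e_i$). For every $i$, either $R_i=1$ or $\psi_i=0$.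 Coordinate $i$ is sampled with probability $p_i>0$, $\sum_ip_i=1$. Sequences. Fix $A_0\ge0$, $B_0>0$ and $S>0$; recursively $a_{t+1}>0$ solves $a_{t+1}^2S^2=A_{t+1}B_{t+1}$ with $A_{t+1}=A_t+a_{t+1}$, $B_{t+1}=B_t+\sigma_Aa_{t+1}$; $\alpha_t=a_{t+1}/A_{t+1}$, $\beta_t=\sigma_Aa_{t+1}/B_{t+1}$, $\eta_{i,t}=\frac{a_{t+1}}{B_{t+1}p_i}$, ${\rm prox}_{\eta\psi_i}(x)=\arg\min_v\frac{1}{2\eta}\|v-x\|^2+\psi_i(v)$. Generalized APCG. $x_0=v_0=0$. For $t=0,1,\dots$: $y_t=\frac{(1-\alpha_t)x_t+\alpha_t(1-\beta_t)v_t}{1-\alpha_t\beta_t}$; sample $i$ with probability $p_i$ independently of the past; $z_{t+1}=v_{t+1}=(1-\beta_t)v_t+\beta_ty_t-\eta_{i,t}\nabla_if_A(y_t)$; replace $v_{t+1}^{(i)}={\rm prox}_{\eta_{i,t}\psi_i}(z_{t+1}^{(i)})$; $x_{t+1}=y_t+\frac{\alpha_tR_i}{p_i}\big(v_{t+1}-(1-\beta_t)v_t-\beta_ty_t\big)$. *)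

(* Defs.v *)
From mathcomp Require Import all_boot all_order all_algebra.
From mathcomp Require Import all_classical all_reals all_analysis.
Import Order.TTheory GRing.Theory Num.Theory numFieldNormedType.Exports.
Set Implicit Arguments. Unset Strict Implicit. Unset Printing Implicit Defensive.
Local Open Scope ring_scope.

Section APCGDefs.
Variables (R : realType).

(* Moore--Penrose pseudo-inverse, via the four Penrose conditions (real case) *)
Definition is_pinv (m d : nat) (A : 'M[R]_(m, d)) (Ad : 'M[R]_(d, m)) : Prop :=
  [/\ A *m Ad *m A = A, Ad *m A *m Ad = Ad,
      (A *m Ad)^T = A *m Ad & (Ad *m A)^T = Ad *m A].

Variable n : nat.
Local Notation d := n.+1.
Local Notation vec := 'cV[R]_d.

Definition evec (i : 'I_d) : vec := delta_mx i 0.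

Definition qform (P : 'M[R]_d) (u : vec) : R := (u^T *m P *m u) 0 0.

Definition sqnorm (u : vec) : R := (u^T *m u) 0 0.

Definition econvex (f : R -> \bar R) : Prop :=
  forall (x y l : R), 0 <= l <= 1 ->
    (f (l * x + (1 - l) * y)%R <= l%:E * f x + (1 - l)%R%:E * f y)%E.

Definition Fobj (fA : vec -> R) (psi : 'I_d -> R -> \bar R) (x : vec) : \bar R :=
  ((fA x)%:E + \sum_(i < d) psi i (x i 0%R))%E.

Definition apcg_alpha (a As : nat -> R) (t : nat) : R := a t.+1 / As t.+1.
Definition apcg_beta (sigmaA : R) (a Bs : nat -> R) (t : nat) : R :=
  sigmaA * a t.+1 / Bs t.+1.
Definition apcg_eta (p : 'I_d -> R) (a Bs : nat -> R) (i : 'I_d) (t : nat) : R :=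
  a t.+1 / (Bs t.+1 * p i).

(* One iteration of generalized APCG with sampled coordinate i at time t.
   P = A^dagger A, grad = gradient of f_A, prox i eta x = prox_{eta psi_i}(x). *)
Definition apcg_step (P : 'M[R]_d) (grad : vec -> vec)
    (prox : 'I_d -> R -> R -> R) (p : 'I_d -> R)
    (alpha beta : nat -> R) (eta : 'I_d -> nat -> R)
    (t : nat) (i : 'I_d) (xv : vec * vec) : vec * vec :=
  let x := xv.1 in let v := xv.2 in
  let y := (1 - alpha t * beta t)^-1 *:
             ((1 - alpha t) *: x + (alpha t * (1 - beta t)) *: v) in
  let w := (1 - beta t) *: v + beta t *: y in
  let z := w - eta i t *: (evec i *m (evec i)^T *m grad y) in
  let v' := \col_(j < d) (if j == i then prox i (eta i t) (z i 0) else z j 0) in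
  let x' := y + (alpha t * P i i / p i) *: (v' - w) in
  (x', v').

(* (x_t, v_t) along a sampling path omega (omega k = coordinate sampled at step k);
   x_0 = v_0 = 0. *)
Fixpoint apcg_run P grad prox p alpha beta eta (omega : nat -> 'I_d) (t : nat)
  : vec * vec :=
  match t with
  | 0 => (0, 0)
  | t'.+1 => apcg_step P grad prox p alpha beta eta t' (omega t')
                (apcg_run P grad prox p alpha beta eta omega t')
  end.

(* extend a finite path of length t to nat -> 'I_d (irrelevant default after t) *)
Definition path_ext (t : nat) (w : {ffun 'I_t -> 'I_d}) : nat -> 'I_d :=
  fun k => odflt ord0 (omap w (insub k)).

Definition path_prob (p : 'I_d -> R) (t : nat) (w : {ffun 'I_t -> 'I_d}) : R :=
  \prod_(k < t) p (w k).

Definition expectR (p : 'I_d -> R) (t : nat) (g : (nat -> 'I_d) -> R) : R :=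
  \sum_(w : {ffun 'I_t -> 'I_d}) path_prob p w * g (path_ext w).

Definition expectE (p : 'I_d -> R) (t : nat) (g : (nat -> 'I_d) -> \bar R) : \bar R :=
  (\sum_(w : {ffun 'I_t -> 'I_d}) (path_prob p w)%:E * g (path_ext w))%E.

End APCGDefs.

Arguments evec {R n}.
Arguments qform {R n}.
Arguments sqnorm {R n}.
Arguments econvex {R}.
Arguments Fobj {R n}.
Arguments apcg_alpha {R}.
Arguments apcg_beta {R}.
Arguments apcg_eta {R n}.
Arguments apcg_step {R n}.
Arguments apcg_run {R n}.
Arguments path_ext {n t}.
Arguments path_prob {R n}.
Arguments expectR {R n}.
Arguments expectE {R n}.

(* Main.v *)
(* The potential [B_t |v_t - theta|^2 + 2 A_t (f(x_t) + \sum_j H_j - F(theta))] is a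
   supermartingale.  Its smooth part is handled by the directional descent lemma, the prox
   inequality and relative strong convexity; averaging over the sampled coordinate turns
   the partial gradients into the full one.

   Where [psi_j] is nonzero, [P j j = 1], and the [j]-th coordinate of [x_t] is a convex
   combination of those of [v_0, ..., v_t] with deterministic weights: with
   [y_t, w_t] eliminated, [x_(t+1) = g x_t - m v_t + (alpha_t / p) v_(t+1)], where
   [g = mix_x], [m = mix_v], and [v_t] has weight [c_t = alpha_(t-1) / p] in [x_t].
   [H_j = hull_value] is the same combination of the [psi_j(v_l)], so it bounds
   [psi_j(x_t)], and its conditional expectation is at most
   [(1 - alpha_t) H_j + alpha_t psi_j(prox)].

   Nonnegativity of the weights amounts to [m <= g c_t].  As [alpha_t beta_t] is the
   constant [sigma / S^2], it follows from the step-size condition at time [t] together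
   with [sigma / S^2 <= p^2], which needs that condition at all times. *)
Require Import Defs.
From mathcomp Require Import all_boot all_order all_algebra.
From mathcomp Require Import all_classical all_reals all_analysis.
From mathcomp Require Import ring lra.
Import Order.TTheory GRing.Theory Num.Theory numFieldNormedType.Exports.
Set Implicit Arguments. Unset Strict Implicit. Unset Printing Implicit Defensive.
Local Open Scope ring_scope.

(** * Descent along a coordinate direction *)

(** The gap between [f] and its quadratic model along the segment has derivative at most 0 by the
    Lipschitz bound, so the mean value theorem on [[0, 1]] gives the claim. *)
Lemma directional_descent (R : realType) (n : nat) (f : 'cV[R]_n.+1 -> R)
    (g : 'cV[R]_n.+1 -> 'cV[R]_n.+1) (i : 'I_n.+1) (L : R) :
  (forall x, differentiable f x) ->
  (forall x h, 'd f x h = ((g x)^T *m h) 0 0) ->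
  (forall x h, `|g (x + h *: evec i) i 0 - g x i 0| <= L * `|h|) ->
  forall x h, f (x + h *: evec i) <= f x + h * g x i 0 + L / 2 * h ^+ 2.
Proof.
move=> fdiff fgrad Lip x h.
pose line (s : R) : 'cV[R]_n.+1 := x + (s * h) *: evec i.
pose phi (s : R) := f (line s) - (s * h * g x i 0 + L / 2 * (s * h) ^+ 2).
pose dphi (s : R) := h * (g (line s) i 0 - g x i 0) - L * s * h ^+ 2.
have dline (s : R) : is_derive s 1 line (h *: evec i).
  have isd : is_diff s line ((0 : R -> 'cV[R]_n.+1) + *:%R^~ (h *: evec i)).
    have -> : line = cst x + *:%R^~ (h *: evec i).
      by apply/funext => r; rewrite /line -scalerA.
    exact: is_diffD.
  apply: DeriveDef; first by apply/derivable1_diffP.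
  by rewrite deriveE // diff_val /= add0r scale1r.
have dfline (s : R) : is_derive s 1 (f \o line) (h * g (line s) i 0).
  have dl : differentiable line s by apply/derivable1_diffP; case: (dline s).
  apply: DeriveDef.
    by apply/derivable1_diffP; apply: differentiable_comp.
  rewrite deriveE; last exact: differentiable_comp.
  rewrite diff_comp //= fgrad -deriveE // (@derive_val _ _ _ _ _ _ _ (dline s)).
  by rewrite -scalemxAr mxE /evec -(colE i (g (line s))^T) !mxE.
have dphiE (s : R) : is_derive s 1 phi (dphi s).
  pose quad (s : R) := s * h * g x i 0 + L / 2 * (s * h) ^+ 2.
  have dquad : is_derive s 1 quad (h * g x i 0 + L * s * h ^+ 2).
    rewrite /quad; apply: is_derive_eq.
    by rewrite /GRing.scale /=; field.
  have := is_deriveB (dfline s) dquad.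
  by congr is_derive; rewrite /dphi; ring.
have cphi : ({within `[0%R, 1%R], continuous phi})%classic.
  apply: derivable_within_continuous => s _; by case: (dphiE s).
have [c c01 E] := MVT_segment ler01 (fun s _ => dphiE s) cphi.
have : dphi c <= 0.
  have := Lip x (c * h); rewrite -/(line c) normrM => lip.
  have c0 : 0 <= c by move: c01; rewrite in_itv /= => /andP[].
  rewrite (ger0_norm c0) in lip.
  have : h * (g (line c) i 0 - g x i 0) <= `|h| * (L * (c * `|h|)).
    rewrite (le_trans (ler_norm _)) // normrM ler_wpM2l //.
  rewrite /dphi -(real_normK (num_real h)); lra.
move: E; rewrite /phi /line mul0r !mul1r scale0r addr0; lra.
Qed.

(** * Extended-valued convex functions and the proximal map *)

Lemma econvex_fin (R : realType) (f : R -> \bar R) (x y l : R) :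
  econvex f -> (forall u, f u != -oo%E) -> 0 <= l <= 1 ->
  f x \is a fin_num -> f y \is a fin_num ->
  f (l * x + (1 - l) * y) \is a fin_num /\
  fine (f (l * x + (1 - l) * y)) <= l * fine (f x) + (1 - l) * fine (f y).
Proof.
move=> cf fN l01 fx fy; have := cf x y l l01.
rewrite -{1}(fineK fx) -{1}(fineK fy) -!EFinM -EFinD.
have := fN (l * x + (1 - l) * y).
by case: (f _) => // r _; rewrite lee_fin.
Qed.

(** Divide by [l] and let [l] tend to 0: minimality along a segment becomes a first-order
    condition. *)
Lemma slope_ge0 (R : realFieldType) (X Y : R) :
  (forall l, 0 < l <= 1 -> 0 <= l * (X + l * Y)) -> 0 <= X.
Proof.
move=> H; rewrite leNgt; apply/negP => X0.
(* This [l] gives [l * Y <= - X / 2], hence [X + l * Y <= X / 2 < 0]; the [- X] in the denominator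
   keeps [l] at most 1. *)
pose l := - X / (2 * (- X + `|Y|)).
have Y0 := normr_ge0 Y.
have d0 : 0 < 2 * (- X + `|Y|) by lra.
have l0 : 0 < l by rewrite divr_gt0 //; lra.
have l1 : l <= 1 by rewrite ler_pdivrMr //; lra.
have := H l; rewrite l0 l1 pmulr_rge0 // => /(_ isT).
have : l * Y <= l * (- X + `|Y|).
  by rewrite ler_pM2l //; have := ler_norm Y; lra.
have -> : l * (- X + `|Y|) = - X / 2 by rewrite /l; field; lra.
lra.
Qed.

Lemma prox_fin_num (R : realType) (f : R -> \bar R) (eta z u th : R) :
  (forall v, f v != -oo%E) -> f th \is a fin_num ->
  (((2 * eta)^-1 * (u - z) ^+ 2)%:E + f u
    <= ((2 * eta)^-1 * (th - z) ^+ 2)%:E + f th)%E ->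
  f u \is a fin_num.
Proof.
move=> fN fth; rewrite -(fineK fth) -EFinD.
by have := fN u; case: (f u).
Qed.

(** Comparing [u] with points on the segment towards [th] gives, to first order, the variational
    inequality of the proximal point; expanding [(th - z) ^ 2] around [u] turns it into this
    form. *)
Lemma prox_three_point (R : realType) (f : R -> \bar R) (eta z u th : R) :
  econvex f -> (forall v, f v != -oo%E) -> 0 < eta ->
  (forall w, ((2 * eta)^-1 * (u - z) ^+ 2)%:E + f u
    <= ((2 * eta)^-1 * (w - z) ^+ 2)%:E + f w)%E ->
  f th \is a fin_num ->
  (u - th) ^+ 2 + (u - z) ^+ 2 + 2 * eta * (fine (f u) - fine (f th))
    <= (th - z) ^+ 2.
Proof.
move=> cf fN eta0 umin fth.
have fu := prox_fin_num fN fth (umin th).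
suff : 0 <= 2 * (th - u) * (u - z) + 2 * eta * (fine (f th) - fine (f u)) by lra.
apply: (@slope_ge0 _ _ ((th - u) ^+ 2)) => l /andP[l0 l1].
have l01 : 0 <= l <= 1 by rewrite ltW.
have [fw cw] := econvex_fin cf fN l01 fth fu.
have := umin (l * th + (1 - l) * u).
rewrite -{1}(fineK fu) -{1}(fineK fw) -!EFinD lee_fin.
set fw' := fine _ in cw *; set fu' := fine (f u) in cw *; set ft := fine _ in cw *.
move=> H.
have {}H : (2 * eta)^-1 * (u - z) ^+ 2 + fu' <=
   (2 * eta)^-1 * (l * th + (1 - l) * u - z) ^+ 2 + (l * ft + (1 - l) * fu').
  by rewrite (le_trans H) // lerD2l.
have e0 : 0 < 2 * eta by lra.
move: H; rewrite -(ler_pM2l e0) !mulrDr !mulrA mulfV ?gt_eqF // !mul1r; lra.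
Qed.

Lemma prox_zero (R : realType) (eta z u : R) : 0 < eta ->
  (forall w, ((2 * eta)^-1 * (u - z) ^+ 2)%:E + 0
    <= ((2 * eta)^-1 * (w - z) ^+ 2)%:E + 0 :> \bar R)%E -> u = z.
Proof.
move=> eta0 /(_ z); rewrite !adde0 lee_fin subrr expr0n mulr0 pmulr_rle0.
  by rewrite real_exprn_even_le0 ?num_real //= subr_eq0 => /eqP.
by rewrite invr_gt0; lra.
Qed.

(** * The seminorm of an orthogonal projection *)

Section Projection.
Variables (R : realType) (n : nat) (P : 'M[R]_n.+1).
Hypotheses (Psym : P^T = P) (Pid : P *m P = P).
Implicit Types (u v : 'cV[R]_n.+1).

Lemma qform_sqnorm u : qform P u = sqnorm (P *m u).
Proof. by rewrite /qform /sqnorm trmx_mul Psym !mulmxA -(mulmxA _ P P) Pid. Qed.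

Lemma sqnormE u : sqnorm u = \sum_i u i 0 ^+ 2.
Proof. by rewrite /sqnorm mxE; apply: eq_bigr => i _; rewrite mxE expr2. Qed.

Lemma qform_ge0 u : 0 <= qform P u.
Proof. by rewrite qform_sqnorm sqnormE sumr_ge0 // => i _; rewrite sqr_ge0. Qed.

Lemma formC u v : (u^T *m P *m v) 0 0 = (v^T *m P *m u) 0 0.
Proof.
have <- : (v^T *m P *m u)^T = u^T *m P *m v by rewrite !trmx_mul trmxK Psym mulmxA.
by rewrite mxE.
Qed.

Lemma qformD u v : qform P (u + v) = qform P u + 2 * (u^T *m P *m v) 0 0 + qform P v.
Proof.
rewrite /qform [(u + v)^T]raddfD /= !mulmxDl !mulmxDr !mxE.
have := formC u v; rewrite !mxE => <-; ring.
Qed.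

Lemma form_scale (k l : R) u v :
  ((k *: u)^T *m P *m (l *: v)) 0 0 = k * l * (u^T *m P *m v) 0 0.
Proof. by rewrite [(k *: u)^T]linearZ /= -!scalemxAl -scalemxAr scalerA mxE. Qed.

Lemma qformZ (k : R) u : qform P (k *: u) = k ^+ 2 * qform P u.
Proof. by rewrite /qform form_scale expr2. Qed.

(** The difference is [|u - P u|^2]. This lets the initial distance be measured in the Euclidean
    norm. *)
Lemma qform_le_sqnorm u : qform P u <= sqnorm u.
Proof.
have : 0 <= sqnorm (u - P *m u).
  by rewrite sqnormE sumr_ge0 // => i _; rewrite sqr_ge0.
have -> : sqnorm (u - P *m u) = sqnorm u - qform P u; last lra.
rewrite /sqnorm [(u - _)^T]raddfB /= trmx_mul Psym mulmxBl !mulmxBr !mulmxA -(mulmxA _ P P) Pid.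
by rewrite subrr subr0 [LHS]mxE [X in _ + X]mxE.
Qed.

(** The gap between the two sides is [l * (1 - l) * qform P (u - v)]. *)
Lemma qform_convex (l : R) u v : 0 <= l <= 1 ->
  qform P ((1 - l) *: u + l *: v) <= (1 - l) * qform P u + l * qform P v.
Proof.
move=> /andP[l0 l1].
have := qform_ge0 (u - v).
have -> : u - v = 1 *: u + (-1) *: v by rewrite scale1r scaleN1r.
rewrite !qformD !qformZ !form_scale; set b := (_ *m v) 0 0 => H.
have : 0 <= l * (1 - l) * (1 ^+ 2 * qform P u + 2 * (1 * -1 * b) + (-1) ^+ 2 * qform P v).
  by rewrite mulr_ge0 // mulr_ge0 // subr_ge0.
lra.
Qed.

Lemma form_evec u (i : 'I_n.+1) : (u^T *m P *m evec i) 0 0 = (P *m u) i 0.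
Proof. by rewrite formC /evec -mulmxA trmx_delta -rowE mxE. Qed.

Lemma qform_evec (i : 'I_n.+1) : qform P (evec i) = P i i.
Proof. by rewrite /qform form_evec /evec -colE mxE. Qed.

Lemma proj_diag_ge0 i : 0 <= P i i.
Proof. by rewrite -qform_evec qform_ge0. Qed.

(* [P i i = |P e_i|^2], so a unit diagonal entry forces [P e_i = e_i]. *)
Lemma proj_diag1 u i : P i i = 1 -> (P *m u) i 0 = u i 0.
Proof.
move=> Pii; rewrite mxE (bigD1 i) //= Pii mul1r big1 ?addr0 // => j ji.
suff -> : P i j = 0 by rewrite mul0r.
have := qform_sqnorm (evec i); rewrite qform_evec Pii sqnormE (bigD1 i) //=.
have PE k : (P *m evec i) k 0 = P k i by rewrite /evec -colE mxE.
rewrite PE Pii expr1n => /eqP; rewrite eq_sym addrC -subr_eq0 addrK psumr_eq0; last first.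
  by move=> k _; rewrite sqr_ge0.
move=> /allP /(_ j (mem_index_enum _)); rewrite ji /= PE sqrf_eq0 => /eqP.
by have -> : P i j = P j i by rewrite -{1}Psym mxE.
Qed.
End Projection.

(** * Expectations over sampling paths *)

Section Expectation.
Variables (R : realType) (n : nat) (p : 'I_n.+1 -> R).
Hypotheses (p_ge0 : forall i, 0 <= p i) (p_sum1 : \sum_i p i = 1).

Lemma path_prob_ge0 t (w : {ffun 'I_t -> 'I_n.+1}) : 0 <= path_prob p t w.
Proof. by rewrite prodr_ge0. Qed.

Definition ffun_rcons t (wi : {ffun 'I_t -> 'I_n.+1} * 'I_n.+1) :
  {ffun 'I_t.+1 -> 'I_n.+1} :=
  [ffun k => if unlift ord_max k is Some j then wi.1 j else wi.2].

Lemma path_ext_ord t (w : {ffun 'I_t -> 'I_n.+1}) (j : 'I_t) : path_ext w j = w j.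
Proof. by rewrite /path_ext valK. Qed.

Lemma val_lift_max t (j : 'I_t) : lift ord_max j = j :> nat.
Proof. by rewrite /= /bump leqNgt ltn_ord add0n. Qed.

Lemma path_ext_rcons_lt t w i k : (k < t)%N ->
  path_ext (@ffun_rcons t (w, i)) k = path_ext w k.
Proof.
move=> kt; rewrite -[k]/(nat_of_ord (Ordinal kt)) path_ext_ord -val_lift_max.
by rewrite path_ext_ord ffunE liftK.
Qed.

Lemma path_ext_rcons_eq t w i : path_ext (@ffun_rcons t (w, i)) t = i.
Proof. by rewrite -[t in LHS]/(nat_of_ord (@ord_max t)) path_ext_ord ffunE unlift_none. Qed.

Lemma path_prob_rcons t w i : path_prob p _ (@ffun_rcons t (w, i)) = path_prob p t w * p i.
Proof.
rewrite /path_prob big_ord_recr /=; congr (_ * _).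
  apply: eq_bigr => k _; rewrite ffunE.
  have -> : widen_ord (leqnSn t) k = lift ord_max k.
    by apply/val_inj; rewrite [RHS]val_lift_max.
  by rewrite liftK.
by rewrite ffunE unlift_none.
Qed.

(** Conditioning on the first [t] samples. [G] takes any [om'] agreeing with [om] before [t],
    because extending a path of length [t] yields a default value, not the sample, at time [t]. *)
Lemma expectR_recr t (g : (nat -> 'I_n.+1) -> R) (G : (nat -> 'I_n.+1) -> 'I_n.+1 -> R) :
  (forall om om' : nat -> 'I_n.+1,
    (forall k, (k < t)%N -> om k = om' k) -> g om = G om' (om t)) ->
  expectR p t.+1 g = expectR p t (fun om => \sum_i p i * G om i).
Proof.
move=> gG; rewrite /expectR (reindex (@ffun_rcons t)) /=; last first.
  exists (fun w => ([ffun j => w (lift ord_max j)], w ord_max)) => [[w i]|w] _.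
    congr pair; last by rewrite ffunE unlift_none.
    by apply/ffunP => j; rewrite !ffunE liftK.
  by apply/ffunP => k; rewrite !ffunE; case: unliftP => [j ->|->]; rewrite ?ffunE.
rewrite -(pair_bigA _ (fun w i => path_prob p _ (ffun_rcons (w, i)) *
  g (path_ext (ffun_rcons (w, i))))) /=.
apply: eq_bigr => w _; rewrite mulr_sumr; apply: eq_bigr => i _.
rewrite path_prob_rcons -mulrA; congr (_ * (_ * _)).
rewrite -[in RHS](@path_ext_rcons_eq t w i); apply: gG => k kt.
exact: path_ext_rcons_lt.
Qed.

Lemma ler_expectR t (g h : (nat -> 'I_n.+1) -> R) :
  (forall om, g om <= h om) -> expectR p t g <= expectR p t h.
Proof. by move=> gh; apply: ler_sum => w _; rewrite ler_wpM2l ?path_prob_ge0. Qed.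

Lemma expectR0 (g : (nat -> 'I_n.+1) -> R) c :
  (forall om, g om = c) -> expectR p 0 g = c.
Proof.
move=> gc; rewrite /expectR (eq_bigr (fun=> c)) => [|w _].
  by rewrite sumr_const card_ffun card_ord card_ord expn0.
by rewrite gc /path_prob big_ord0 mul1r.
Qed.

Lemma expectR_cst t (c : R) : expectR p t (fun=> c) = c.
Proof.
elim: t => [|t IH]; first exact: expectR0.
rewrite (expectR_recr (G := fun=> fun=> c)) // -[in RHS]IH; congr expectR.
by apply/funext => om; rewrite -mulr_suml p_sum1 mul1r.
Qed.

Lemma expectR_linear t (k l : R) (g h : (nat -> 'I_n.+1) -> R) :
  expectR p t (fun om => k * g om + l * h om) = k * expectR p t g + l * expectR p t h.
Proof.
rewrite /expectR !mulr_sumr -big_split /=; apply: eq_bigr => w _; ring.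
Qed.

Lemma lee_expectE t (g : (nat -> 'I_n.+1) -> \bar R) (h : (nat -> 'I_n.+1) -> R) :
  (forall om, g om <= (h om)%:E)%E -> (expectE p t g <= (expectR p t h)%:E)%E.
Proof.
move=> gh; rewrite /expectR -sumEFin; apply: lee_sum => w _.
by rewrite EFinM lee_wpmul2l // lee_fin path_prob_ge0.
Qed.
End Expectation.

(** * Mixing coefficients of one iteration *)

Definition mix_x (R : fieldType) (al be p : R) : R :=
  (1 - al) * (1 - al * be / p) / (1 - al * be).
Definition mix_v (R : fieldType) (al be p : R) : R :=
  al * (p^-1 - 1) * (1 - be) / (1 - al * be).

Section Mixing.
Variables (R : realFieldType) (al be p : R).
Hypotheses (al01 : 0 < al <= 1) (be01 : 0 <= be < 1) (p01 : 0 < p <= 1).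
Hypothesis (step : al / p <= 1 - be).

Lemma albe_lt1 : 0 < 1 - al * be.
Proof.
move: (al01) (be01) => ? ?.
have : 0 <= (1 - al) * be by apply: mulr_ge0; lra.
lra.
Qed.

Lemma mix_sum1 : mix_x al be p - mix_v al be p + al / p = 1.
Proof.
move: (al01) (be01) (p01) => ? ? ?.
have ab := albe_lt1; have p0 : 0 < p by case/andP: p01.
rewrite /mix_x /mix_v; field; lra.
Qed.

Lemma albe_div_le : al * be / p <= be.
Proof.
move: (al01) (be01) (p01) (step) => ? ? ? ?.
have -> : al * be / p = be * (al / p) by ring.
by rewrite ler_piMr //; lra.
Qed.

Lemma mix_x_ge0 : 0 <= mix_x al be p.
Proof.
move: (al01) (be01) (p01) (step) => ? ? ? ?.
have ab := albe_lt1; have := albe_div_le => h.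
by rewrite /mix_x divr_ge0 ?mulr_ge0 //; lra.
Qed.

(** The core of [mix_v_le], with [u], [w] standing for consecutive values of [a]. Squaring and
    substituting for [u ^ 2] leaves [(1 - p) ^ 2 * (1 - be) <= (1 - al) * (1 - d) ^ 2] with
    [d = al * be / p]. *)
Lemma momentum_ineq (u w : R) : 0 <= u -> 0 <= w -> al * be <= p ^+ 2 ->
  u ^+ 2 = w ^+ 2 * ((1 - al) * (1 - be)) ->
  w * ((1 - p) * (1 - be)) <= u * (1 - al * be / p).
Proof.
move: (al01) (be01) (p01) (step) => ? ? ? ?.
move=> u0 w0 q uw; have dl := albe_div_le.
have p0 : 0 < p by case/andP: p01.
have alp : al <= p.
  have : al / p <= 1 by lra.
  by rewrite ler_pdivrMr // mul1r.
have dp : al * be / p <= p by rewrite ler_pdivrMr // -expr2.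
rewrite -(@ler_pXn2r _ 2) ?nnegrE ?mulr_ge0 //; try lra.
rewrite !exprMn uw; move: dl dp; set d := al * be / p => dl dp.
(* Factor by factor, from [al <= p], [d <= p] and [d <= be]. *)
have : (1 - be) * ((1 - p) * ((1 - p) * (1 - be))) <=
       (1 - be) * ((1 - al) * ((1 - d) * (1 - d))).
  apply: ler_wpM2l; first lra.
  apply: ler_pM; [lra| |lra|]; first by apply: mulr_ge0; lra.
  by apply: ler_pM; lra.
move=> /(ler_wpM2l (sqr_ge0 w)); lra.
Qed.
End Mixing.

(** * The step-size sequences *)

Section Sequences.
Variables (R : realType) (sigma S : R) (a As Bs : nat -> R).
Hypotheses (sigma0 : 0 <= sigma) (S0 : 0 < S) (A00 : 0 <= As 0) (B00 : 0 < Bs 0).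
Hypotheses (a0 : forall t, 0 < a t.+1) (AsS : forall t, As t.+1 = As t + a t.+1).
Hypothesis (BsS : forall t, Bs t.+1 = Bs t + sigma * a t.+1).
Hypothesis (aE : forall t, a t.+1 ^+ 2 * S ^+ 2 = As t.+1 * Bs t.+1).
Local Notation al := (apcg_alpha a As).
Local Notation be := (apcg_beta sigma a Bs).

Lemma As_ge0 t : 0 <= As t.
Proof. by elim: t => // t IH; rewrite AsS addr_ge0 // ltW. Qed.

Lemma As_gt0 t : 0 < As t.+1.
Proof. by rewrite AsS ltr_wpDl ?As_ge0. Qed.

Lemma Bs_gt0 t : 0 < Bs t.
Proof. by elim: t => // t IH; rewrite BsS ltr_wpDr // mulr_ge0 // ltW. Qed.

Lemma a_alpha t : a t.+1 = al t * As t.+1.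
Proof. by rewrite /apcg_alpha divfK // gt_eqF // As_gt0. Qed.

Lemma a_beta t : sigma * a t.+1 = be t * Bs t.+1.
Proof. by rewrite /apcg_beta divfK // gt_eqF // Bs_gt0. Qed.

Lemma As_alpha t : As t = (1 - al t) * As t.+1.
Proof. by rewrite mulrBl mul1r -a_alpha AsS addrK. Qed.

Lemma Bs_beta t : Bs t = (1 - be t) * Bs t.+1.
Proof. by rewrite mulrBl mul1r -a_beta BsS addrK. Qed.

Lemma alpha01 t : 0 < al t <= 1.
Proof.
rewrite /apcg_alpha divr_gt0 ?As_gt0 //= ler_pdivrMr ?As_gt0 // mul1r AsS.
by rewrite lerDr As_ge0.
Qed.

Lemma beta01 t : 0 <= be t < 1.
Proof.
rewrite /apcg_beta divr_ge0 ?mulr_ge0 ?(ltW (Bs_gt0 _)) ?(ltW (a0 _)) //=.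
by rewrite ltr_pdivrMr ?Bs_gt0 // mul1r BsS ltrDr Bs_gt0.
Qed.

Lemma alpha_beta t : al t * be t = sigma / S ^+ 2.
Proof.
have A0 := As_gt0 t; have B0 := Bs_gt0 t.+1.
have S2 : S ^+ 2 != 0 by rewrite gt_eqF // exprn_gt0.
apply: (mulIf S2); rewrite divfK //.
apply: (@mulIf _ (As t.+1 * Bs t.+1)); first by rewrite gt_eqF // mulr_gt0.
rewrite -[in RHS]aE /apcg_alpha /apcg_beta; field; lra.
Qed.

Lemma As_lb t : t%:R * a 1 <= As t.
Proof.
have aS k : a 1 <= a k.+1.
  rewrite -(@ler_pXn2r _ 2) ?nnegrE ?(ltW (a0 _)) // -(@ler_pM2r _ (S ^+ 2)) ?exprn_gt0 //.
  rewrite !aE ler_pM ?(ltW (As_gt0 _)) ?(ltW (Bs_gt0 _)) //.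
    elim: k => // k IH; rewrite (le_trans IH) // (AsS k.+1) lerDl ltW //.
  by elim: k => // k IH; rewrite (le_trans IH) // (BsS k.+1) lerDl mulr_ge0 // ltW.
elim: t => [|t IH]; first by rewrite mul0r.
by rewrite AsS mulrSr mulrDl mul1r lerD.
Qed.

(* Otherwise [al t <= p] would keep [Bs / As] below [p ^ 2 * S ^ 2 < sigma], whereas
   [Bs / As] tends to [sigma] because [As] is unbounded. *)
Lemma alpha_bounded (p : R) : 0 < p -> (forall t, al t <= p) -> sigma / S ^+ 2 <= p ^+ 2.
Proof.
move=> p0 alp; rewrite ler_pdivrMr ?exprn_gt0 // leNgt; apply/negP => gap.
have BA t : Bs t = Bs 0 + sigma * (As t - As 0).
  elim: t => [|t IH]; first by rewrite subrr mulr0 addr0.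
  rewrite BsS IH AsS; ring.
have ratio t : Bs t.+1 <= p ^+ 2 * S ^+ 2 * As t.+1.
  rewrite -(ler_pM2l (As_gt0 t)) -aE a_alpha exprMn.
  have -> : As t.+1 * (p ^+ 2 * S ^+ 2 * As t.+1) = p ^+ 2 * As t.+1 ^+ 2 * S ^+ 2 by ring.
  rewrite ler_pM2r ?exprn_gt0 // ler_pM2r ?exprn_gt0 ?As_gt0 //.
  by rewrite ler_pXn2r ?nnegrE ?(ltW p0) //; case/andP: (alpha01 t) => /ltW.
pose e := sigma - p ^+ 2 * S ^+ 2.
have e0 : 0 < e by rewrite subr_gt0.
(* [ratio] and [BA] give [e * As t.+1 <= sigma * As 0 - Bs 0], while [As_lb] makes the left side
   unbounded. *)
have bnd t : e * (t.+1%:R * a 1) <= sigma * As 0.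
  have := ratio t; rewrite BA => H.
  have := As_lb t.+1; rewrite -(ler_pM2l e0) => /le_trans; apply.
  rewrite /e; have := B00; lra.
have ea : 0 < e * a 1 by rewrite mulr_gt0.
have h0 : 0 <= sigma * As 0 / (e * a 1) by rewrite divr_ge0 ?mulr_ge0 // ltW.
have := archi_boundP h0; set N := Num.bound _.
rewrite ltr_pdivrMr // => lt1.
have := bnd N; rewrite leNgt => /negP; apply; rewrite (lt_le_trans lt1) //.
have -> : e * (N.+1%:R * a 1) = N.+1%:R * (e * a 1) by ring.
by rewrite ler_pM2r // ler_nat.
Qed.

(** The weight of [v_t] in [x_t]; it is 1 at time 0 because [x_0 = v_0]. *)
Definition weight (p : R) (t : nat) : R := if t is t'.+1 then al t' / p else 1.

Section Weights.
Variable p : R.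
Hypotheses (p01 : 0 < p <= 1) (step : forall t, al t / p <= 1 - be t).

Lemma alpha_div_le1 t : al t / p <= 1.
Proof. by rewrite (le_trans (step t)) //; have := beta01 t; lra. Qed.

Lemma weight01 t : 0 <= weight p t <= 1.
Proof.
case: t => [|t] /=; first by rewrite ler01 lexx.
rewrite alpha_div_le1 andbT divr_ge0 //; first by case/andP: (alpha01 t) => /ltW.
by case/andP: p01 => /ltW.
Qed.

Lemma mix_v_le t : mix_v (al t) (be t) p <= mix_x (al t) (be t) p * weight p t.
Proof.
have p0 : 0 < p by case/andP: p01.
case: t => [|t] /=.
  (* At time 0 the claim is [m <= g], and [g - m = 1 - al / p] by [mix_sum1]. *)
  rewrite mulr1 -subr_ge0.
  have := mix_sum1 (alpha01 0) (beta01 0) p01.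
  have := alpha_div_le1 0; lra.
have albe := albe_lt1 (alpha01 t.+1) (beta01 t.+1).
have alp k : al k <= p by have := alpha_div_le1 k; rewrite ler_pdivrMr // mul1r.
have q : al t.+1 * be t.+1 <= p ^+ 2 by rewrite alpha_beta alpha_bounded.
have sq : a t.+1 ^+ 2 = a t.+2 ^+ 2 * ((1 - al t.+1) * (1 - be t.+1)).
  apply: (@mulIf _ (S ^+ 2)); first by rewrite gt_eqF // exprn_gt0.
  rewrite aE (As_alpha t.+1) (Bs_beta t.+1).
  transitivity ((1 - al t.+1) * (1 - be t.+1) * (a t.+2 ^+ 2 * S ^+ 2)); last ring.
  by rewrite aE; ring.
have := momentum_ineq (alpha01 _) (beta01 _) p01 (step _) (ltW (a0 _)) (ltW (a0 _)) q sq.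
rewrite /mix_v /mix_x => H.
rewrite [leRHS]mulrAC ler_pM2r ?invr_gt0 //.
(* Multiplying by [As t.+2 * p] turns the ratios [al] into values of [a], and the claim into
   [momentum_ineq]. *)
rewrite -(ler_pM2r (As_gt0 t.+1)) -(ler_pM2r p0).
move: H; rewrite (a_alpha t.+1) (a_alpha t) (As_alpha t.+1).
set X := al t.+1 * be t.+1 / p.
have -> : al t.+1 * (p^-1 - 1) * (1 - be t.+1) * As t.+2 * p =
  al t.+1 * As t.+2 * ((1 - p) * (1 - be t.+1)) by field; lra.
have -> : (1 - al t.+1) * (1 - X) * (al t / p) * As t.+2 * p =
  al t * ((1 - al t.+1) * As t.+2) * (1 - X) by field; lra.
by [].
Qed.
End Weights.
End Sequences.

(** * Convex-hull representation of one coordinate *)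

Section HullBound.
Variables (R : realType) (f : R -> \bar R).
Hypotheses (cf : econvex f) (fN : forall v, f v != -oo%E).

(* [H] bounds [f x] through a representation of [x] as a convex combination in which
   [v] has weight [c]. *)
Definition hull_bound (c x v H : R) : Prop :=
  exists s, [/\ f v \is a fin_num, f s \is a fin_num, x = c * v + (1 - c) * s
    & c * fine (f v) + (1 - c) * fine (f s) <= H].

Lemma hull_bound_le c x v H : 0 <= c <= 1 -> hull_bound c x v H ->
  f x \is a fin_num /\ fine (f x) <= H.
Proof.
move=> c01 [s [fv fs -> le]]; have [h1 h2] := econvex_fin cf fN c01 fv fs.
by split=> //; exact: le_trans le.
Qed.

Variables (al be p : R).
Hypotheses (al01 : 0 < al <= 1) (be01 : 0 <= be < 1) (p01 : 0 < p <= 1).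
Hypothesis (step : al / p <= 1 - be).

(** Substituting the old representation writes the new point as [(g c - m) v + g (1 - c) s + c' v'],
    with nonnegative weights summing to 1. The new residual point is the normalised combination of
    [v] and [s]. *)
Lemma hull_bound_step c x v H y w v' :
  0 <= c <= 1 -> mix_v al be p <= mix_x al be p * c ->
  y = (1 - al * be)^-1 * ((1 - al) * x + al * (1 - be) * v) ->
  w = (1 - be) * v + be * y ->
  f v' \is a fin_num ->
  hull_bound c x v H ->
  hull_bound (al / p) (y + al / p * (v' - w)) v'
    (mix_x al be p * H - mix_v al be p * fine (f v) + al / p * fine (f v')).
Proof.
move: (al01) (be01) (p01) (step) => ? ? ? st.
move=> c01 mc yE wE fv' [s [fv fs xE HE]].
have ab := albe_lt1 al01 be01; have sum1 := mix_sum1 al01 be01 p01.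
have gx := mix_x_ge0 al01 be01 p01 step.
have p0 : 0 < p by case/andP: p01.
have x'E : y + al / p * (v' - w) =
   mix_x al be p * x - mix_v al be p * v + al / p * v'.
  by rewrite wE yE /mix_x /mix_v; field; lra.
set g := mix_x _ _ _ in mc sum1 gx x'E *; set m := mix_v _ _ _ in mc sum1 x'E *.
set c' := al / p in sum1 x'E st *.
have k1 : 0 <= g * c - m by lra.
have k2 : 0 <= g * (1 - c) by rewrite mulr_ge0 //; lra.
have bound : (g * c - m) * fine (f v) + g * (1 - c) * fine (f s) + c' * fine (f v')
    <= g * H - m * fine (f v) + c' * fine (f v').
  by have := ler_wpM2l gx HE; lra.
(* With [c' = 1] the weights of [v] and [s] vanish and cannot be normalised; [v'] serves as a
   residual point with finite value. *)
have [c1|c1] := eqVneq c' 1.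
  have z2 : g * (1 - c) = 0 by lra.
  have z1 : g * c - m = 0 by lra.
  exists v'; split=> //.
    rewrite x'E xE c1 subrr mul0r addr0.
    have -> : g * (c * v + (1 - c) * s) - m * v = (g * c - m) * v + g * (1 - c) * s by ring.
    by rewrite z1 z2; ring.
  rewrite c1 subrr mul0r addr0; rewrite c1 z1 z2 in bound; lra.
have c'1 : 0 < 1 - c' by rewrite subr_gt0 lt_neqAle c1 /=; lra.
pose l := (g * c - m) / (1 - c').
have lE : 1 - l = g * (1 - c) / (1 - c') 
  by apply: (mulIf (lt0r_neq0 c'1)); rewrite mulrBl !divfK ?lt0r_neq0 //; lra.
have l01 : 0 <= l <= 1.
  rewrite divr_ge0 //= ?(ltW c'1) // -subr_ge0 lE divr_ge0 // ltW //.
have [fl cl] := econvex_fin cf fN l01 fv fs.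
exists (l * v + (1 - l) * s); split=> //.
  by rewrite lE /l x'E xE; field; lra.
apply: le_trans bound; rewrite [leRHS]addrC lerD2l.
have := ler_wpM2l (ltW c'1) cl; rewrite lE => /le_trans; apply.
rewrite /l le_eqVlt; apply/orP; left; apply/eqP; field; lra.
Qed.

(** When the coordinate is not sampled, [v] moves to [w], a convex combination
    [k * v + (1 - k) * x]. Convexity bounds [f w], and the weight that [f v] thereby gains in the
    mean is exactly [mix_v], so the terms in [f v] cancel. *)
Lemma hull_bound_mean c x v H y w u :
  0 <= c <= 1 ->
  y = (1 - al * be)^-1 * ((1 - al) * x + al * (1 - be) * v) ->
  w = (1 - be) * v + be * y ->
  hull_bound c x v H ->
  f w \is a fin_num /\
  p * (mix_x al be p * H - mix_v al be p * fine (f v) + al / p * fine (f u)) +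
  (1 - p) * (mix_x al be p * H - mix_v al be p * fine (f v) + al / p * fine (f w))
  <= (1 - al) * H + al * fine (f u).
Proof.
move: (al01) (be01) (p01) => ? ? ?.
move=> c01 yE wE hb; have [fx xH] := hull_bound_le c01 hb.
have [_ [fv _ _ _]] := hb.
have ab := albe_lt1 al01 be01; have p0 : 0 < p by case/andP: p01.
pose k := (1 - be) / (1 - al * be).
have kE : 1 - k = be * (1 - al) / (1 - al * be) by rewrite /k; field; lra.
have k01 : 0 <= k <= 1.
  rewrite divr_ge0 ?(ltW ab) //=; last lra.
  by rewrite -subr_ge0 kE divr_ge0 ?(ltW ab) // mulr_ge0; lra.
have [fw cw] := econvex_fin cf fN k01 fv fx.
have wE' : w = k * v + (1 - k) * x by rewrite kE /k wE yE; field; lra.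
rewrite -wE' in fw cw; split=> //.
have n0 : 0 <= (1 - p) * (al / p).
  by rewrite mulr_ge0 ?divr_ge0 ?(ltW p0) //; lra.
have {}cw : fine (f w) <= k * fine (f v) + (1 - k) * H.
  by rewrite (le_trans cw) // lerD2l ler_wpM2l //; lra.
have := ler_wpM2l n0 cw.
have -> : (1 - p) * (al / p) * (k * fine (f v) + (1 - k) * H) =
   mix_v al be p * fine (f v) + (1 - al - mix_x al be p) * H.
  by rewrite kE /k /mix_v /mix_x; field; lra.
have -> : p * (mix_x al be p * H - mix_v al be p * fine (f v) + al / p * fine (f u)) =
  p * (mix_x al be p * H - mix_v al be p * fine (f v)) + al * fine (f u) by field; lra.
lra.
Qed.
End HullBound.

(** * One iteration of the algorithm *)

Section Analysis.
Variables (R : realType) (n : nat) (P : 'M[R]_n.+1).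
Variables (fA : 'cV[R]_n.+1 -> R) (grad : 'cV[R]_n.+1 -> 'cV[R]_n.+1) (sigma : R).
Variables (M : 'I_n.+1 -> R) (psi : 'I_n.+1 -> R -> \bar R).
Variables (prox : 'I_n.+1 -> R -> R -> R) (p : 'I_n.+1 -> R).
Variables (S : R) (a As Bs : nat -> R) (theta : 'cV[R]_n.+1).
Hypotheses (Psym : P^T = P) (Pid : P *m P = P).
Hypothesis fdiff : forall x, differentiable fA x.
Hypothesis fgrad : forall x h, 'd fA x h = ((grad x)^T *m h) 0 0.
Hypothesis sigma0 : 0 <= sigma.
Hypothesis strong : forall x y, fA x - fA y >=
  ((grad y)^T *m P *m (x - y)) 0 0 + sigma / 2 * qform P (x - y).
Hypothesis smooth : forall i x h,
  `|grad (x + h *: evec i) i 0 - grad x i 0| <= M i * `|h|.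
Hypothesis cpsi : forall i, econvex (psi i).
Hypothesis psiN : forall i x, psi i x != -oo%E.
Hypothesis dichotomy : forall i, P i i = 1 \/ (forall u, psi i u = 0%E).
Hypotheses (p0 : forall i, 0 < p i) (psum : \sum_i p i = 1).
Hypothesis proxP : forall i eta x, 0 < eta -> forall w,
  (((2 * eta)^-1 * (prox i eta x - x) ^+ 2)%R%:E + psi i (prox i eta x)
   <= ((2 * eta)^-1 * (w - x) ^+ 2)%R%:E + psi i w)%E.
Hypotheses (S0 : 0 < S) (A00 : 0 <= As 0) (B00 : 0 < Bs 0).
Hypotheses (a0 : forall t, 0 < a t.+1) (AsS : forall t, As t.+1 = As t + a t.+1).
Hypothesis BsS : forall t, Bs t.+1 = Bs t + sigma * a t.+1.
Hypothesis aE : forall t, a t.+1 ^+ 2 * S ^+ 2 = As t.+1 * Bs t.+1.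
Hypothesis theta_fin : forall i, psi i (theta i 0) \is a fin_num.
Hypothesis S_ge : forall i, S ^+ 2 >= M i * P i i / p i ^+ 2.
Local Notation al := (apcg_alpha a As).
Local Notation be := (apcg_beta sigma a Bs).
Local Notation eta := (apcg_eta p a Bs).
Hypothesis steps : forall i t, 1 - be t - al t * P i i / p i >= 0.
Local Notation step := (apcg_step P grad prox p al be eta).
Local Notation psiR i u := (fine (psi i u)).
Local Notation alpha01 := (alpha01 A00 a0 AsS).
Local Notation beta01 := (beta01 sigma0 B00 a0 BsS).
Local Notation As_gt0 := (As_gt0 A00 a0 AsS).
Local Notation As_ge0 := (As_ge0 A00 a0 AsS).
Local Notation Bs_gt0 := (Bs_gt0 sigma0 B00 a0 BsS).

Lemma p_le1 i : 0 < p i <= 1.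
Proof.
by rewrite p0 -psum (bigD1 i) //= lerDl sumr_ge0 // => j _; rewrite ltW.
Qed.

Lemma p_eq1 i j : p j = 1 -> i = j.
Proof.
move=> pj; apply/eqP/negPn/negP => ij.
have := psum; rewrite (bigD1 j) //= (bigD1 i) //= pj => E.
have : 0 <= \sum_(k | (k != j) && (k != i)) p k by rewrite sumr_ge0 // => k _; rewrite ltW.
have := p0 i; lra.
Qed.

Lemma eta_gt0 i t : 0 < eta i t.
Proof. by rewrite divr_gt0 // mulr_gt0 // Bs_gt0. Qed.

Definition hull_update (t : nat) (j : 'I_n.+1) (H : R) (v v' : 'cV[R]_n.+1) : R :=
  mix_x (al t) (be t) (p j) * H - mix_v (al t) (be t) (p j) * psiR j (v j 0)
  + al t / p j * psiR j (v' j 0).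

Section OneStep.
Variables (t : nat) (x v : 'cV[R]_n.+1).
Let y := (1 - al t * be t)^-1 *: ((1 - al t) *: x + (al t * (1 - be t)) *: v).
Let w := (1 - be t) *: v + be t *: y.
(** Where coordinate [i] of [v] lands if [i] is sampled. Having it for all [i] at once lets sums
    over [i] express means over the sample. *)
Definition prox_point i := prox i (eta i t) (w i 0 - eta i t * grad y i 0).

Lemma step_v i : (step t i (x, v)).2 = w + (prox_point i - w i 0) *: evec i.
Proof.
apply/matrixP => j k; rewrite !ord1 /= -/y -/w !mxE.
have gE l : (evec i *m (evec i)^T *m grad y) l 0 = (l == i)%:R * grad y i 0.
  by rewrite -mulmxA /evec trmx_delta -rowE mxE big_ord1 !mxE eqxx andbT.
have := gE i; have := gE j; rewrite !mxE => -> ->; rewrite eqxx mul1r andbT.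
case: eqP => [->|_]; first by rewrite mulr1 [RHS]addrC subrK /prox_point /w !mxE.
by rewrite mul0r !mulr0 subr0 addr0.
Qed.

Lemma step_x i :
  (step t i (x, v)).1 = y + (al t * P i i / p i * (prox_point i - w i 0)) *: evec i.
Proof.
have /= := step_v i; rewrite -/y -/w /= => ->.
by rewrite [w + _]addrC addrK scalerA.
Qed.

Lemma psi_u_fin i : psi i (prox_point i) \is a fin_num.
Proof. by apply: (prox_fin_num (psiN i) (theta_fin i)); apply: proxP; exact: eta_gt0. Qed.

(** If [P i i = 1], then [P] preserves coordinate [i] and the three-point inequality applies to it.
    If [psi i = 0], the step is a plain gradient step and equality holds. *)
Lemma step_dist i :
  qform P ((step t i (x, v)).2 - theta) <= qform P (w - theta)
    - 2 * eta i t * grad y i 0 * (P *m (w - theta)) i 0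
    - P i i * ((prox_point i - w i 0) ^+ 2 + 2 * eta i t * grad y i 0 * (prox_point i - w i 0))
    + 2 * eta i t * (psiR i (theta i 0) - psiR i (prox_point i)).
Proof.
set d := prox_point i - w i 0; rewrite step_v -/d addrAC qformD //.
rewrite -(scale1r (w - theta)) form_scale qformZ.
rewrite scale1r form_evec // qform_evec // mul1r.
have eta0 := eta_gt0 i t.
have [Pii|psi0] := dichotomy i.
  have := prox_three_point (cpsi i) (psiN i) eta0 (@proxP _ _ _ eta0) (theta_fin i).
  move=> /(_ (w i 0 - eta i t * grad y i 0)); rewrite -/(prox_point i) proj_diag1 // Pii.
  rewrite [(w - theta) _ _]mxE [(- theta) _ _]mxE.
  have -> : prox_point i = d + w i 0 by rewrite /d; ring.
  set pu := fine _; set pt := fine _; lra.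
rewrite !psi0 /= subrr mulr0 addr0.
have uE : prox_point i = w i 0 - eta i t * grad y i 0.
  apply: (prox_zero eta0) => w'.
  have := @proxP i _ (w i 0 - eta i t * grad y i 0) eta0 w'; rewrite !psi0; exact.
have -> : d = - (eta i t * grad y i 0) by rewrite /d uE; ring.
lra.
Qed.

Lemma step_coordinate i :
  Bs t.+1 * qform P ((step t i (x, v)).2 - theta) + 2 * As t.+1 * fA (step t i (x, v)).1
  <= Bs t.+1 * qform P (w - theta) + 2 * As t.+1 * fA y
     + 2 * (a t.+1 / p i) * (psiR i (theta i 0) - psiR i (prox_point i)
                             - grad y i 0 * (P *m (w - theta)) i 0).
Proof.
have Bp := Bs_gt0 t.+1; have Ap := As_gt0 t; have pp := p0 i.
have := step_dist i; rewrite -(ler_pM2l Bp) /=; set d := prox_point i - w i 0 => Hd.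
have A2 : 0 <= 2 * As t.+1 by lra.
have := directional_descent fdiff fgrad (smooth i) y (al t * P i i / p i * d).
rewrite -step_x => /(ler_wpM2l A2) Hf.
have Pii := proj_diag_ge0 Psym Pid i.
(* The [M i] term of the descent lemma is absorbed by the [- P i i * d ^ 2] of [step_dist]; the
   lower bound on [S] serves this. *)
have quad : As t.+1 * M i * (al t * P i i / p i * d) ^+ 2 <= Bs t.+1 * P i i * d ^+ 2.
  have -> : As t.+1 * M i * (al t * P i i / p i * d) ^+ 2 =
     (As t.+1 * al t ^+ 2 * (P i i * d ^+ 2)) * (M i * P i i / p i ^+ 2).
    by field; lra.
  have c0 : 0 <= As t.+1 * al t ^+ 2 * (P i i * d ^+ 2).
    by apply: mulr_ge0; apply: mulr_ge0; rewrite ?sqr_ge0 ?(ltW Ap).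
  rewrite (le_trans (ler_wpM2l c0 (S_ge i))) // le_eqVlt; apply/orP; left; apply/eqP.
  apply: (mulfI (lt0r_neq0 Ap)).
  transitivity ((al t * As t.+1) ^+ 2 * S ^+ 2 * (P i i * d ^+ 2)); first ring.
  by rewrite -(a_alpha A00 a0 AsS) aE; ring.
have aA := a_alpha A00 a0 AsS t.
have eE : Bs t.+1 * eta i t = a t.+1 / p i by rewrite /apcg_eta; field; lra.
(* Since [Bs t.+1 * eta i t = a t.+1 / p i = As t.+1 * al t / p i], the gradient terms along the
   move [d] cancel. *)
have cross : 2 * As t.+1 * (al t * P i i / p i * d * grad y i 0) =
   2 * (Bs t.+1 * eta i t) * P i i * grad y i 0 * d.
  by rewrite eE aA; ring.
rewrite -eE.
set pt := fine _ in Hd *; set pu := fine _ in Hd *.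
lra.
Qed.

Lemma form_grad_sum (g z : 'cV[R]_n.+1) :
  \sum_i g i 0 * (P *m z) i 0 = (g^T *m P *m z) 0 0.
Proof. by rewrite -mulmxA [RHS]mxE; apply: eq_bigr => i _; rewrite [g^T _ _]mxE. Qed.

Lemma step_smooth_part :
  \sum_i p i * (Bs t.+1 * qform P ((step t i (x, v)).2 - theta)
                + 2 * As t.+1 * fA (step t i (x, v)).1)
  <= Bs t * qform P (v - theta) + 2 * As t * fA x
     + 2 * a t.+1 * (fA theta + \sum_i (psiR i (theta i 0) - psiR i (prox_point i))).
Proof.
have Ap := As_gt0 t; have Bp := Bs_gt0 t.+1; have ap := a0 t.
pose K := Bs t.+1 * qform P (w - theta) + 2 * As t.+1 * fA y.
have -> : Bs t * qform P (v - theta) + 2 * As t * fA x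
     + 2 * a t.+1 * (fA theta + \sum_i (psiR i (theta i 0) - psiR i (prox_point i))) =
  Bs t * qform P (v - theta) + 2 * As t * fA x + 2 * a t.+1 * fA theta +
   2 * a t.+1 * \sum_i (psiR i (theta i 0) - psiR i (prox_point i)) by ring.
(* Averaging: the factor [p i] cancels the [1 / p i] of the step, so the partial gradients add up to
   the full one. *)
apply: (@le_trans _ _ (K + 2 * a t.+1 * (\sum_i (psiR i (theta i 0) - psiR i (prox_point i))
   - ((grad y)^T *m P *m (w - theta)) 0 0))).
  have -> : K = \sum_i p i * K by rewrite -mulr_suml psum mul1r.
  rewrite -form_grad_sum -sumrB mulr_sumr -big_split.
  apply: ler_sum => i _; have pi0 := p0 i.
  have := ler_wpM2l (ltW pi0) (step_coordinate i); rewrite -/K.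
  move=> /le_trans; apply; rewrite mulrDr lerD2l le_eqVlt; apply/orP; left; apply/eqP.
  by field; lra.
have aA := a_alpha A00 a0 AsS t; have AA := As_alpha A00 a0 AsS t.
have aB := a_beta sigma0 B00 a0 BsS t; have BB := Bs_beta sigma0 B00 a0 BsS t.
have al1 := alpha01 t; have be1 := beta01 t.
have be01' : 0 <= be t <= 1 by lra.
have ab := albe_lt1 al1 be1.
(* The extra [sigma * a t.+1 * qform P (y - theta)] is cancelled below by strong convexity between
   [theta] and [y]. *)
have conv : Bs t.+1 * qform P (w - theta) <=
    Bs t * qform P (v - theta) + sigma * a t.+1 * qform P (y - theta).
  have -> : w - theta = (1 - be t) *: (v - theta) + be t *: (y - theta).
    by rewrite /w !scalerBr addrACA -opprD -scalerDl subrK scale1r.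
  rewrite aB BB; have := ler_wpM2l (ltW Bp) (qform_convex Psym Pid (v - theta) (y - theta) be01').
  lra.
(* The choice of [y] makes [a t.+1 *: (w - y)] equal to [As t *: (y - x)], so the linear term splits
   into one convexity inequality at [theta] and one at [x]. *)
have dir : a t.+1 *: (w - theta) = a t.+1 *: (y - theta) + As t *: (y - x).
  apply/matrixP => j k; rewrite ord1 aA AA /w !mxE.
  by field; lra.
have sgt := strong theta y; have sgx := strong x y.
have lin : a t.+1 * ((grad y)^T *m P *m (w - theta)) 0 0 =
    - (a t.+1 * ((grad y)^T *m P *m (theta - y)) 0 0
       + As t * ((grad y)^T *m P *m (x - y)) 0 0).
  have E (k : R) z : k * ((grad y)^T *m P *m z) 0 0 = ((grad y)^T *m P *m (k *: z)) 0 0.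
    by rewrite -scalemxAr [RHS]mxE.
  have N z : ((grad y)^T *m P *m - z) 0 0 = - ((grad y)^T *m P *m z) 0 0.
    by rewrite mulmxN [LHS]mxE.
  rewrite !E dir mulmxDr [LHS]mxE -(opprB y theta) -(opprB y x) !scalerN !N.
  by rewrite opprD !opprK.
have qs : qform P (theta - y) = qform P (y - theta).
  by rewrite -opprB -scaleN1r qformZ; ring.
have qx : 0 <= sigma / 2 * qform P (x - y).
  by rewrite mulr_ge0 ?divr_ge0 ?qform_ge0.
rewrite qs in sgt.
have {}sgt := ler_wpM2l (ltW ap) sgt.
have {}sgx : ((grad y)^T *m P *m (x - y)) 0 0 <= fA x - fA y by lra.
have {}sgx := ler_wpM2l (As_ge0 t) sgx.
have AE := AsS t.
rewrite /K AE; set s := \sum_i _; lra.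
Qed.
(** The bound on [H] is assumed only for [0 < As t], since [psi j] may be infinite at the starting
    point when [As 0 = 0]. *)
Lemma step_hull_bound j H : P j j = 1 ->
  (0 < As t -> hull_bound (psi j) (weight a As (p j) t) (x j 0) (v j 0) H) ->
  (forall i, hull_bound (psi j) (weight a As (p j) t.+1) ((step t i (x, v)).1 j 0)
     ((step t i (x, v)).2 j 0) (hull_update t j H v (step t i (x, v)).2)) /\
  \sum_i p i * hull_update t j H v (step t i (x, v)).2
    <= (1 - al t) * H + al t * psiR j (prox_point j).
Proof.
move=> Pj hb.
have p01 := p_le1 j; have pj := p0 j; have al1 := alpha01 t; have be1 := beta01 t.
have st k : al k / p j <= 1 - be k by have := steps j k; rewrite Pj mulr1; lra.
have vE i : (step t i (x, v)).2 j 0 = if i == j then prox_point j else w j 0.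
  rewrite step_v mxE [X in _ + X = _]mxE [evec i j 0]mxE andbT eq_sym.
  by case: eqP => [->|_]; rewrite ?mulr1 ?mulr0 ?addr0 // addrC subrK.
have xE i : (step t i (x, v)).1 j 0 =
    y j 0 + al t / p j * ((step t i (x, v)).2 j 0 - w j 0).
  rewrite vE step_x mxE [X in _ + X = _]mxE [evec i j 0]mxE andbT eq_sym.
  by case: eqP => [->|_]; rewrite ?Pj ?mulr1 // subrr !mulr0.
have uf := psi_u_fin j.
have yE : y j 0 = (1 - al t * be t)^-1 *
    ((1 - al t) * x j 0 + al t * (1 - be t) * v j 0) by rewrite !mxE.
have wE : w j 0 = (1 - be t) * v j 0 + be t * y j 0.
  by rewrite /w mxE [X in X + _]mxE [X in _ + X]mxE.
have sumE (f : R -> R) : \sum_i p i * f ((step t i (x, v)).2 j 0) =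
    p j * f (prox_point j) + (1 - p j) * f (w j 0).
  rewrite (bigD1 j) // vE eqxx; congr (_ + _).
  rewrite -psum [X in (X - _) * _](bigD1 j) // addrAC subrr add0r mulr_suml.
  by apply: eq_bigr => i /andP[_ ij]; rewrite vE (negbTE ij).
rewrite (sumE (fun z => mix_x (al t) (be t) (p j) * H
  - mix_v (al t) (be t) (p j) * psiR j (v j 0) + al t / p j * psiR j z)).
have [A1|A1] := ltP 0 (As t).
  have w01 := weight01 sigma0 A00 B00 a0 AsS BsS p01 st t.
  have [wf mean] := hull_bound_mean (cpsi j) (psiN j) al1 be1 p01 (prox_point j) w01 yE wE (hb A1).
  split=> // i; rewrite xE; apply: hull_bound_step (hb A1) => //.
  - exact: (mix_v_le sigma0 S0 A00 B00 a0 AsS BsS aE p01 st).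
  - by rewrite vE; case: eqP.
(* [As t = 0] gives [al t = 1], so the step-size condition forces [p j = 1]: [j] is the
   only coordinate, and nothing need be known about [H]. *)
have At0 : As t = 0 by apply/eqP; rewrite eq_le A1 As_ge0.
have alE : al t = 1.
  have /eqP := As_alpha A00 a0 AsS t; rewrite At0 eq_sym mulf_eq0 (gt_eqF (As_gt0 t)) orbF.
  by rewrite subr_eq0 => /eqP.
have pE : p j = 1.
  have := st t; rewrite alE mul1r => h.
  have : (p j)^-1 <= 1 by lra.
  by rewrite invf_le1 // => h'; lra.
have beE : be t = 0 by have := st t; rewrite alE pE divr1; lra.
have mx0 : mix_x (al t) (be t) (p j) = 0 by rewrite /mix_x alE subrr !mul0r.
have mv0 : mix_v (al t) (be t) (p j) = 0.
  by rewrite /mix_v pE invr1 subrr mulr0 !mul0r.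
split=> [i|]; last first.
  by rewrite mx0 mv0 alE pE; lra.
have ij : i = j by exact: p_eq1.
have vf : psi j ((step t i (x, v)).2 j 0) \is a fin_num by rewrite vE ij eqxx.
exists ((step t i (x, v)).2 j 0); split=> //.
  by rewrite xE wE yE /= alE beE pE invr1; field.
by rewrite /hull_update mx0 mv0 /= alE pE; lra.
Qed.
End OneStep.

(** * The potential along a sampling path *)

Local Notation run := (apcg_run P grad prox p al be eta).

(** If [psi j 0] is infinite, [fine] starts the recursion at 0. [psi0_fin] confines this to
    [As 0 = 0], where [potential] gives the sum weight 0 and the first update discards the value. *)
Fixpoint hull_value (om : nat -> 'I_n.+1) (t : nat) (j : 'I_n.+1) : R :=
  if t is t'.+1 then
    hull_update t' j (hull_value om t' j) (run om t').2 (run om t).2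
  else psiR j 0.

Hypothesis psi0_fin : 0 < As 0 -> forall j, psi j 0 \is a fin_num.

Lemma hull_value0 om t j : (forall r, psi j r = 0%E) -> hull_value om t j = 0.
Proof.
move=> z; elim: t => [|t IH] /=; first by rewrite z.
by rewrite /hull_update IH !z /= !mulr0 subr0 addr0.
Qed.

Lemma run_hull_bound om t j : P j j = 1 -> 0 < As t ->
  hull_bound (psi j) (weight a As (p j) t) ((run om t).1 j 0) ((run om t).2 j 0)
    (hull_value om t j).
Proof.
move=> Pj; elim: t => [|t IH] A0.
  exists 0; rewrite /= !mxE; split; rewrite ?psi0_fin //; first by rewrite !mulr0 addr0.
  by rewrite subrr mul0r addr0 mul1r.
have [+ _] := step_hull_bound Pj IH.
by move=> /(_ (om t)); rewrite -surjective_pairing.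
Qed.

Lemma run_psi_le om t j : 0 < As t ->
  (psi j ((run om t).1 j 0%R) <= (hull_value om t j)%:E)%E.
Proof.
move=> A0; have [Pj|z] := dichotomy j; last by rewrite z hull_value0.
have p01 := p_le1 j.
have st k : al k / p j <= 1 - be k by have := steps j k; rewrite Pj mulr1; lra.
have w01 := weight01 sigma0 A00 B00 a0 AsS BsS p01 st t.
have [xf xle] := hull_bound_le (cpsi j) (psiN j) w01 (run_hull_bound om Pj A0).
by rewrite -(fineK xf) lee_fin.
Qed.

Let Ftheta := fA theta + \sum_i psiR i (theta i 0).

Definition potential (t : nat) (xv : 'cV[R]_n.+1 * 'cV[R]_n.+1) (H : 'I_n.+1 -> R) : R :=
  Bs t * qform P (xv.2 - theta) + 2 * As t * (fA xv.1 + \sum_j H j - Ftheta).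

(** The smooth part leaves [- 2 * a t.+1] times the sum of [psi] at the prox points; the hull values
    contribute the same sum with a plus sign, and the two cancel. *)
Lemma potential_step om t :
  \sum_i p i * potential t.+1 (step t i (run om t))
    (fun j => hull_update t j (hull_value om t j) (run om t).2 (step t i (run om t)).2)
  <= potential t (run om t) (hull_value om t).
Proof.
rewrite [run om t]surjective_pairing.
set x := (run om t).1; set v := (run om t).2.
have sm := step_smooth_part t x v.
have psi_part j : \sum_i p i * hull_update t j (hull_value om t j) v (step t i (x, v)).2
    <= (1 - al t) * hull_value om t j + al t * psiR j (prox_point t x v j).
  have [Pj|z] := dichotomy j.
    by have [_] := step_hull_bound Pj (@run_hull_bound om t j Pj).
  rewrite hull_value0 // z /= !mulr0 addr0 big1 // => i _.
  by rewrite /hull_update !z /= !mulr0 subr0 addr0 mulr0.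
have Ap := As_gt0 t.
have aA := a_alpha A00 a0 AsS t; have AA := As_alpha A00 a0 AsS t.
have {}psi_part : 2 * As t.+1 * (\sum_i p i *
     \sum_j hull_update t j (hull_value om t j) v (step t i (x, v)).2)
   <= 2 * As t * \sum_j hull_value om t j + 2 * a t.+1 * \sum_j psiR j (prox_point t x v j).
  rewrite (eq_bigr (fun i => \sum_j p i *
    hull_update t j (hull_value om t j) v (step t i (x, v)).2)); last first.
    by move=> i _; rewrite mulr_sumr.
  rewrite exchange_big /=; have A2 : 0 <= 2 * As t.+1 by lra.
  have := ler_wpM2l A2 (ler_sum (index_enum _) (P := predT) (fun j _ => psi_part j)).
  move=> /le_trans; apply; rewrite big_split /= -!mulr_sumr aA AA.
  by rewrite le_eqVlt; apply/orP; left; apply/eqP; ring.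
rewrite /potential /=.
rewrite (eq_bigr (fun i => p i * (Bs t.+1 * qform P ((step t i (x, v)).2 - theta)
     + 2 * As t.+1 * fA (step t i (x, v)).1)
   + (2 * As t.+1 * (p i * \sum_j hull_update t j (hull_value om t j) v (step t i (x, v)).2)
   + p i * - (2 * As t.+1 * Ftheta)))); last by move=> i _; ring.
rewrite big_split big_split /= -mulr_sumr -mulr_suml psum mul1r.
move: sm psi_part; rewrite sumrB /Ftheta (AsS t) => sm psi_part.
set s1 := \sum_i psiR i (theta i 0) in sm *; lra.
Qed.
Lemma run_prefix om om' t : (forall k, (k < t)%N -> om k = om' k) -> run om t = run om' t.
Proof.
elim: t => [//|t IH] omE; have /= -> := omE t (ltnSn t).
by rewrite IH // => k kt; rewrite omE // ltnW.
Qed.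

Lemma hull_value_prefix om om' t :
  (forall k, (k < t)%N -> om k = om' k) -> hull_value om t = hull_value om' t.
Proof.
elim: t => [//|t IH] omE; apply/funext => j.
have omE' k : (k < t)%N -> om k = om' k by move=> kt; rewrite omE // ltnW.
by rewrite [LHS]/= [RHS]/= (IH omE') (run_prefix omE') omE.
Qed.

Lemma expect_potential t :
  expectR p t (fun om => potential t (run om t) (hull_value om t))
  <= potential 0 (0, 0) (fun j => psiR j 0).
Proof.
elim: t => [|t IH]; first by rewrite (expectR0 _ (c := potential 0 (0, 0) (fun j => psiR j 0))).
apply: le_trans IH.
rewrite (@expectR_recr _ _ p t _ (fun om i => potential t.+1 (step t i (run om t))
    (fun j => hull_update t j (hull_value om t j) (run om t).2 (step t i (run om t)).2))).
  by apply: ler_expectR => [i|om]; [exact: ltW | exact: potential_step].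
move=> om om' omE.
rewrite -(run_prefix omE) -(hull_value_prefix omE) //.
Qed.

Lemma apcg_bound t :
  ((Bs t * expectR p t (fun om => qform P ((run om t).2 - theta)))%R%:E
   + (2 * As t)%R%:E * (expectE p t (fun om => Fobj fA psi (run om t).1) - Ftheta%:E)
   <= (potential 0 (0, 0) (fun j => psiR j 0))%:E)%E.
Proof.
pose e := expectR p t (fun om => fA (run om t).1 + \sum_j hull_value om t j).
have p_ge0 i : 0 <= p i by exact: ltW.
have potE : expectR p t (fun om => potential t (run om t) (hull_value om t)) =
    Bs t * expectR p t (fun om => qform P ((run om t).2 - theta)) + 2 * As t * (e - Ftheta).
  transitivity (expectR p t (fun om => Bs t * qform P ((run om t).2 - theta)
      + 2 * As t * (1 * (fA (run om t).1 + \sum_j hull_value om t j) + -1 * Ftheta))).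
    by congr expectR; apply/funext => om; rewrite /potential mul1r mulN1r.
  by rewrite !expectR_linear expectR_cst // mul1r mulN1r.
apply: (@le_trans _ _ (Bs t * expectR p t (fun om => qform P ((run om t).2 - theta))
    + 2 * As t * (e - Ftheta))%:E); last by rewrite lee_fin -potE expect_potential.
rewrite [leRHS]EFinD leeD2l // [leRHS]EFinM.
(* When [As t = 0] the expected objective may be [+oo], but its product with 0 is 0. *)
have [A0|A0] := ltP 0 (As t); last first.
  have -> : As t = 0 by apply/eqP; rewrite eq_le A0 As_ge0.
  by rewrite mulr0 !mul0e.
rewrite lee_wpmul2l ?lee_fin ?mulr_ge0 ?(ltW A0) // EFinB leeD2r //.
apply: lee_expectE => // om; rewrite /Fobj EFinD leeD2l // -sumEFin.
by apply: lee_sum => j _; exact: run_psi_le.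
Qed.
End Analysis.

(** * Finite objective values and the final bound *)

Lemma Fobj_fin (R : realType) (n : nat) (f : 'cV[R]_n.+1 -> R)
    (psi : 'I_n.+1 -> R -> \bar R) (x : 'cV[R]_n.+1) :
  (forall i u, psi i u != -oo%E) -> (Fobj f psi x < +oo)%E ->
  (forall i, psi i (x i 0) \is a fin_num) /\
  Fobj f psi x = (f x + \sum_i fine (psi i (x i 0)))%:E.
Proof.
move=> psiN Fx.
have psif i : psi i (x i 0) \is a fin_num.
  rewrite fin_numE psiN /=; apply/eqP => psiy.
  suff /eqP E : (\sum_i psi i (x i 0%R) == +oo)%E by rewrite /Fobj E in Fx.
  by rewrite esum_eqy //; apply/existsP; exists i; rewrite psiy /=.
split=> //; rewrite /Fobj EFinD -sumEFin; congr (_ + _)%E.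
by apply: eq_bigr => i _; rewrite fineK.
Qed.


Theorem theorem4 (R : realType) (m n : nat)
    (A : 'M[R]_(m, n.+1)) (Ad : 'M[R]_(n.+1, m))
    (fA : 'cV[R]_n.+1 -> R) (grad : 'cV[R]_n.+1 -> 'cV[R]_n.+1) (sigmaA : R)
    (M : 'I_n.+1 -> R) (psi : 'I_n.+1 -> R -> \bar R)
    (prox : 'I_n.+1 -> R -> R -> R) (p : 'I_n.+1 -> R)
    (A0 B0 S : R) (a As Bs : nat -> R) (theta : 'cV[R]_n.+1) :
  is_pinv A Ad ->
  (* f_A differentiable with gradient grad *)
  (forall x, differentiable fA x) ->
  (forall x h, 'd fA x h = ((grad x)^T *m h) 0 0) ->
  (* relative strong convexity *)
  0 <= sigmaA ->
  (forall x y, fA x - fA y >=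
     ((grad y)^T *m (Ad *m A) *m (x - y)) 0 0 + sigmaA / 2 * qform (Ad *m A) (x - y)) ->
  (* M_i-smoothness in direction i *)
  (forall i x h, `|grad (x + h *: evec i) i 0 - grad x i 0| <= M i * `|h|) ->
  (* psi_i convex, R -> R U {+oo} *)
  (forall i, econvex (psi i)) ->
  (forall i x, psi i x != -oo%E) ->
  (forall i, (Ad *m A) i i = 1 \/ (forall u, psi i u = 0%E)) ->
  (* sampling probabilities *)
  (forall i, 0 < p i) -> \sum_(i < n.+1) p i = 1 ->
  (* prox i eta x is a minimizer of v |-> (v - x)^2/(2 eta) + psi_i(v) *)
  (forall i eta x, 0 < eta -> forall w,
     (((2 * eta)^-1 * (prox i eta x - x) ^+ 2)%R%:E + psi i (prox i eta x)
      <= ((2 * eta)^-1 * (w - x) ^+ 2)%R%:E + psi i w)%E) ->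
  (* the sequences a_t, A_t, B_t *)
  0 <= A0 -> 0 < B0 -> 0 < S ->
  As 0%N = A0 -> Bs 0%N = B0 ->
  (forall t, 0 < a t.+1) ->
  (forall t, As t.+1 = As t + a t.+1) ->
  (forall t, Bs t.+1 = Bs t + sigmaA * a t.+1) ->
  (forall t, a t.+1 ^+ 2 * S ^+ 2 = As t.+1 * Bs t.+1) ->
  (* theta is a minimizer of the (proper) objective F *)
  (exists x0, (Fobj fA psi x0 < +oo)%E) ->
  (forall x, (Fobj fA psi theta <= Fobj fA psi x)%E) ->
  (* step-size conditions *)
  (forall i, S ^+ 2 >= M i * (Ad *m A) i i / p i ^+ 2) ->
  (forall i t, 1 - apcg_beta sigmaA a Bs t - apcg_alpha a As t * (Ad *m A) i i / p i >= 0) ->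
  forall t : nat,
    let run := apcg_run (Ad *m A) grad prox p (apcg_alpha a As)
                 (apcg_beta sigmaA a Bs) (apcg_eta p a Bs) in
    ((Bs t * expectR p t (fun omega => qform (Ad *m A) ((run omega t).2 - theta)))%R%:E
     + (2 * As t)%R%:E
       * (expectE p t (fun omega => Fobj fA psi (run omega t).1) - Fobj fA psi theta)
     <= (B0 * sqnorm (0 - theta))%R%:E + (2 * A0)%R%:E * (Fobj fA psi 0 - Fobj fA psi theta))%E.
Proof.
move=> [_ AdAAd _ Psym] fdiff fgrad sigma0 strong smooth cpsi psiN dichotomy p0 psum proxP.
move=> A00 B00 S0 As0 Bs0 a0 AsS BsS aE [x0 Fx0] thetaP S_ge steps t; cbv zeta.
have Pid : (Ad *m A) *m (Ad *m A) = Ad *m A by rewrite mulmxA AdAAd.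
have [theta_fin FthetaE] := Fobj_fin psiN (le_lt_trans (thetaP x0) Fx0).
subst A0 B0.
have bound := apcg_bound Psym Pid fdiff fgrad sigma0 strong smooth cpsi psiN dichotomy p0 psum
  proxP S0 A00 B00 a0 AsS BsS aE theta_fin S_ge steps.
have Bq : Bs 0%N * qform (Ad *m A) (0 - theta) <= Bs 0%N * sqnorm (0 - theta).
  by rewrite ler_pM2l // qform_le_sqnorm.
(* If [As 0 = 0], the term in [F(0)] is 0 even for infinite [F(0)]; if [0 < As 0] and [F(0)] is
   infinite, the right-hand side is [+oo]. *)
have [A0|A0] := ltP 0 (As 0%N); last first.
  have A0E : As 0%N = 0 by apply/eqP; rewrite eq_le A0 A00.
  rewrite A0E mulr0 mul0e adde0 FthetaE.
  apply: le_trans (bound _ t) _; first by rewrite A0E ltxx.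
  by rewrite lee_fin /potential A0E mulr0 mul0r addr0.
have [F0|] := ltP (Fobj fA psi 0) +oo%E; last first.
  rewrite leye_eq => /eqP ->; rewrite FthetaE addye // gt0_muley ?lte_fin ?mulr_gt0 //.
  by rewrite addey ?leey.
have [psi0_fin F0E] := Fobj_fin psiN F0.
have psi0E i : fine (psi i ((0 : 'cV[R]_n.+1) i 0)) = fine (psi i 0) by rewrite mxE.
rewrite F0E FthetaE; apply: le_trans (bound _ t) _.
  by move=> _ j; have := psi0_fin j; rewrite mxE.
rewrite -EFinB -EFinM -EFinD lee_fin /potential lerD //=.
by rewrite (eq_bigr _ (fun i _ => psi0E i)).
Qed.
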